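(* Let $G$ be a finite graph. If the square cover $\mathcal U^\square_G$ of $G$ is infinite, then $\gamma_G(n)=\Theta(n)$.
   Context: Graphs are undirected, connected, without multiple edges, self-loops allowed; $V_G$, $E_G$ are the sets of vertices and edges of $G$. Walks: a walk on $G$ is a non-empty word $p=p_0\dots p_n$ of vertices with $(p_i,p_{i+1})\in E_G$ for all $i<n$; its length is $l(p)=n$. A cycle is a walk $c$ with $c_0=c_{l(c)}$. A spine on $a$ is a cycle of length $2$ starting and ending at $a$. A walk is non-backtracking if it has no spine as a subword (of consecutive letters). $\varphi(p)$ denotes the walk obtained from $p$ by successively replacing every spine $aba$ by $a$ until none is left (the result does not depend on the order). For a walk $p$, $0\le k\le l(p)$ and a cycle $s$ with $s_0=p_k$, $p\oplus_k s=p_0\dots p_{k-1}\,s\,p_{k+1}\dots p_{l(p)}$ ($p_k$ is replaced by the word $s$). A square is a non-backtracking cycle of length $4$. Two non-backtracking walks $p,q$ differ by a square if there are an integer $k$ and a square $s$ with $q=\varphi(p\oplus_k s)$ or $p=\varphi(q\oplus_k s)$. $\sim_\square$ is the equivalence relation on non-backtracking walks generated by this relation. Square cover: for $a\in V_G$, $\mathcal U_G[a]$ is the graph whose vertices are the non-backtracking walks on $G$ beginning at $a$, with edges the pairs $(p,q)$ such that $p=qv$ or $q=pv$ for some $v\in V_G$. $\mathcal U^\square_G[a]$ is its quotient by $\sim_\square$: vertices are equivalence classes, with an edge between two classes if there is an edge of $\mathcal U_G[a]$ between some elements of these classes. The graphs $\mathcal U^\square_G[a]$, $a\in V_G$, are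 all isomorphic; their isomorphism class is the square cover $\mathcal U^\square_G$ of $G$. Hom shift: $X_G\subset V_G^{\mathbb Z^2}$ is the set of all $x$ such that $(x_{\mathbf u},x_{\mathbf v})\in E_G$ whenever $\mathbf u,\mathbf v\in\mathbb Z^2$ satisfy $\|\mathbf u-\mathbf v\|_1=1$. Block gluing: $\mathbb N=\{0,1,\dots\}$, $\mathbb N^*=\{1,2,\dots\}$. A block pattern of size $n\ge1$ is an element of $\mathcal A^{\{0,\dots,n-1\}^2}$; it is globally admissible for a shift $X\subset\mathcal A^{\mathbb Z^2}$ if it appears in some element of $X$. $\delta(\mathbb U,\mathbb U')=\min_{\mathbf u\in\mathbb U,\mathbf u'\in\mathbb U'}\|\mathbf u-\mathbf u'\|_\infty$. For $f:\mathbb N^*\to\mathbb N$, $k\in\mathbb N^*$, $X$ is $(f,k)$-phased block gluing if for all $n\ge1$, all globally admissible block patterns $p,p'$ of size $n$ and all $\mathbf u,\mathbf u'$ with $\delta(\mathbf u+\{0,\dots,n-1\}^2,\mathbf u'+\{0,\dots,n-1\}^2)\ge f(n)$, there are $x\in X$ and $\mathbf v\in\mathbb Z^2$ with $\|\mathbf v\|_\infty<k$ such that $x$ restricted to $\mathbf u+\{0,\dots,n-1\}^2$ is $p$ and $x$ restricted to $\mathbf u'+\mathbf v+\{0,\dots,n-1\}^2$ is $p'$. For finite connected $G$, $X_G$ is $(f,k)$-phased block gluing for some $(f,k)$; its phase $\theta$ is the minimal such $k$, and $\gamma_G:\mathbb N^*\to\mathbb N$ is the pointwise minimal function such that $X_G$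 is $(\gamma_G,\theta)$-phased block gluing. $g(n)=O(f(n))$ means there are $c,K>0$ with $g(n)\le c f(n)+K$ for all $n\ge 1$; $g(n)=\Theta(f(n))$ means $g(n)=O(f(n))$ and $f(n)=O(g(n))$. *)

(* Defs.v *)
From Stdlib Require Export Relation_Operators.
From HB Require Export structures.
From mathcomp Require Export all_boot all_order all_algebra.
From mathcomp Require Export boolp classical_sets cardinality.

Set Implicit Arguments.
Unset Strict Implicit.
Unset Printing Implicit Defensive.

Import GRing.Theory.

Local Open Scope nat_scope.

(* A finite graph is a finType [V] of vertices with a symmetric relation
   [e : rel V]; loops are allowed, so [e] need not be irreflexive. *)

Section Walks.
Variables (V : finType) (e : rel V).
Implicit Types p q s : seq V.

Definition walk p : bool := (p != [::]) && sorted e p.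

(* [p_0 ... p_n] has length [n], not [n.+1]. *)
Definition walk_length p : nat := (size p).-1.

Definition closed_walk p : bool := walk p && (ohead p == onth p (walk_length p)).

Definition spine s : bool := closed_walk s && (walk_length s == 2).

(* The spines are exactly the walks of the form [:: a; b; a]. *)
Definition nonbacktracking p : bool :=
  walk p && [forall a, forall b, spine [:: a; b; a] ==> ~~ infix [:: a; b; a] p].

(* Replaces the leftmost spine [:: a; b; a] of a walk by [:: a]. *)
Fixpoint cut_spine p : seq V :=
  if p is a :: p' then
    if p' is _ :: c :: q then
      if a == c then c :: q else a :: cut_spine p'
    else p
  else p.

(* [size p] rounds suffice: each effective one removes two letters. *)
Definition phi p : seq V := iter (size p) cut_spine p.

(* [p (+)_k s]: the letter of index [k] of [p] is replaced by the word [s]. *)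
Definition insert_cycle p (k : nat) s : seq V := take k p ++ s ++ drop k.+1 p.

Definition square s : bool :=
  [&& nonbacktracking s, closed_walk s & walk_length s == 4].

Definition add_square p q : Prop :=
  exists k s, [/\ k <= walk_length p, square s, ohead s = onth p k
                & q = phi (insert_cycle p k s)].

Definition differ_by_square p q : Prop :=
  [/\ nonbacktracking p, nonbacktracking q & add_square p q \/ add_square q p].

Definition square_equiv : seq V -> seq V -> Prop :=
  @clos_refl_sym_trans (seq V) differ_by_square.

End Walks.

Record graph (T : Type) := Graph {
  vertices : set T;
  adjacent : T -> T -> Prop
}.

Definition infinite_graph (T : Type) (G : graph T) : Prop :=
  infinite_set (vertices G).

(* The classes of [R] that meet the vertex set of [G]; it is used below with
   [R] preserving that vertex set. *)
Definition quotient_graph (T : Type) (G : graph T) (R : T -> T -> Prop) :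
    graph (set T) :=
  let classes := [set C | exists2 p, vertices G p & C = [set q | R p q]]%classic in
  Graph classes
    (fun C D => [/\ classes C, classes D &
       exists p q, [/\ C p, D q & adjacent G p q]]).

Definition universal_cover (V : finType) (e : rel V) (a : V) : graph (seq V) :=
  let vs := [set p | nonbacktracking e p /\ ohead p = Some a]%classic in
  Graph vs
    (fun p q => [/\ vs p, vs q & exists v, p = rcons q v \/ q = rcons p v]).

Definition square_cover (V : finType) (e : rel V) (a : V) : graph (set (seq V)) :=
  quotient_graph (universal_cover e a) (square_equiv e).

Definition norm1 (u : int * int) : nat := absz u.1 + absz u.2.

Definition norm_inf (u : int * int) : nat := maxn (absz u.1) (absz u.2).

Definition hom_shift (V : finType) (e : rel V) : set (int * int -> V) :=
  [set x | forall u v : int * int, norm1 (u - v)%R = 1 -> e (x u) (x v)]%classic.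

Section BlockGluing.
Variables (A : finType) (X : set (int * int -> A)).

Definition block_pattern (n : nat) : Type := {ffun 'I_n * 'I_n -> A}.

(* The point of [u + {0, ..., n-1}^2] with relative position [i]. *)
Definition block_point (n : nat) (u : int * int) (i : 'I_n * 'I_n) : int * int :=
  (u + (i.1%:Z, i.2%:Z))%R.

Definition appears_at n (x : int * int -> A) (u : int * int)
    (p : block_pattern n) : Prop :=
  forall i, x (block_point u i) = p i.

Definition globally_admissible n (p : block_pattern n) : Prop :=
  exists x u, X x /\ appears_at x u p.

(* The distance [delta] between [u + {0, ..., n-1}^2] and
   [u' + {0, ..., n-1}^2].  For [n >= 1] the default value of the minimum is
   attained, at the two lower left corners, hence does not alter it. *)
Definition block_dist (n : nat) (u u' : int * int) : nat :=
  \big[Order.min/norm_inf (u - u')%R]_(ij : ('I_n * 'I_n) * ('I_n * 'I_n))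
     norm_inf (block_point u ij.1 - block_point u' ij.2)%R.

(* Only the values of [f] at positive arguments matter. *)
Definition phased_block_gluing (f : nat -> nat) (k : nat) : Prop :=
  forall n, 0 < n -> forall p p' : block_pattern n,
    globally_admissible p -> globally_admissible p' ->
    forall u u', f n <= block_dist n u u' ->
    exists x v, [/\ X x, norm_inf v < k, appears_at x u p
                  & appears_at x (u' + v)%R p'].

(* The minimal positive [k] for which some [f] works; [0] if there is none. *)
Definition phase : nat :=
  let P := [set k | 0 < k /\ exists f, phased_block_gluing f k]%classic in
  xget 0 [set k | P k /\ forall j, P j -> k <= j]%classic.

(* The pointwise minimal gluing function at the phase; its value at [0] is
   unspecified. *)
Definition gap_function : nat -> nat :=
  xget (fun=> 0)
    [set f | phased_block_gluing f phase /\
       forall g, phased_block_gluing g phase ->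
         forall n, 0 < n -> f n <= g n]%classic.

End BlockGluing.

Definition gamma (V : finType) (e : rel V) : nat -> nat :=
  gap_function (hom_shift e).

Definition big_O (g f : nat -> nat) : Prop :=
  exists c K, [/\ 0 < c, 0 < K & forall n, 0 < n -> g n <= c * f n + K].

Definition big_Theta (g f : nat -> nat) : Prop := big_O g f /\ big_O f g.

(* Main.v *)
Require Import Defs.
From mathcomp Require Import zify.

(* Upper bound: composing a configuration with a graph endomorphism of Z^2 that
   fixes an n-block and folds the plane turns the configuration, from n columns
   beyond the block on, into a checkerboard on one edge of G; two checkerboards
   are joined along a walk of G.  The parity of that walk is the only obstruction,
   which a shift by one unit removes; if the phase is 1, gluing blocks of size 1
   already shows that there is no parity obstruction.

   Lower bound: a unit square of Z^2 maps to a closed walk of length 4, which is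
   trivial in the square cover.  Hence in a configuration that carries a walk w
   on a row and a checkerboard g rows below, w is square-equivalent to a walk of
   length about 2g.  If the square cover is infinite, there are walks of every
   length that are not equivalent to any shorter one. *)

Set Implicit Arguments.
Unset Strict Implicit.
Unset Printing Implicit Defensive.

Import Order.TTheory GRing.Theory Num.Theory.
Local Open Scope nat_scope.

(** * Free reduction of walks by a stack *)

Section Reduction.
Variable V : finType.
Implicit Types (p q u v : seq V) (a b c d w x : V).

Definition reduced p := forall u a b v, p <> u ++ a :: b :: a :: v.

(* Stacks are reversed walks: [push] appends a letter at the end of the walk and
   cancels the spine that this may create. *)
Definition push q w :=
  if q is x :: y :: q' then if w == y then y :: q' else w :: q else w :: q.

Lemma reduced_cons x p : reduced (x :: p) -> reduced p.
Proof. by move=> h u a b v Ep; apply: (h (x :: u) a b v); rewrite Ep. Qed.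

Lemma reduced_cons3 x y z p : x != z -> reduced (y :: z :: p) -> reduced [:: x, y, z & p].
Proof.
move=> xz h [|t u] a b v /=; first by case=> ? _ ?; subst; rewrite eqxx in xz.
by case=> _ E; apply: (h u a b v); rewrite -E.
Qed.

Lemma reduced_rev p : reduced p -> reduced (rev p).
Proof.
move=> h u a b v E; apply: (h (rev v) a b (rev u)).
by rewrite -[p]revK E rev_cat !rev_cons -!cats1 -!catA.
Qed.

Lemma reduced_push q w : reduced q -> reduced (push q w).
Proof.
case: q => [|x [|y q]] h /=.
- by case=> [|? [|? []]] ? ? ?.
- by case=> [|? [|? []]] ? ? ?.
case: eqVneq => [_|ne]; first exact: reduced_cons h.
exact: reduced_cons3.
Qed.

Lemma ohead_push q w : ohead (push q w) = Some w.
Proof. by case: q => [|x [|y q]] //=; case: eqP => //= ->. Qed.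

(** Either [b] is stacked on [a] and [a] cancels it, or [b] cancels the top letter [a]; in the
    latter case [a] is stacked again, because [q] contains no spine. *)
Lemma push_push q a b : reduced q -> ohead q = Some a -> push (push q b) a = q.
Proof.
case: q => [//|x q] h /= [] <-{a}; case: q h => [|y q] h /=; first by rewrite eqxx.
case: (eqVneq b y) => [_|ne] /=; last by rewrite eqxx.
case: q h => [//|z q] h; case: (eqVneq x z) => // E; subst.
by case: (h [::] z y q).
Qed.

Definition reduce p := foldl push [::] p.

Lemma reduced_foldl q p : reduced q -> reduced (foldl push q p).
Proof. by elim: p q => //= w p IHp q redq; exact/IHp/reduced_push. Qed.

Lemma reduced_reduce p : reduced (reduce p).
Proof. by apply: reduced_foldl; case=> [|? []]. Qed.

(** The word [rev (belast a r)] is the way back to [a] along [r]. *)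
Lemma foldl_cancel q a r : reduced q -> ohead q = Some a ->
  foldl push q (r ++ rev (belast a r)) = q.
Proof.
elim: r q a => [//|b r IHr] q a redq qa /=.
rewrite rev_cons -cats1 catA foldl_cat IHr ?ohead_push //=.
  by rewrite push_push.
exact: reduced_push.
Qed.

Lemma foldl_cut_spine q p :
  reduced q -> foldl push q (cut_spine p) = foldl push q p.
Proof.
elim: p q => //= a [|b [|c p]] IHp q redq //.
case: eqVneq => [->|_].
  by rewrite /= (push_push (q := push q c)) ?ohead_push //; exact: reduced_push.
exact/IHp/reduced_push.
Qed.

Lemma foldl_reduced q p :
  reduced (catrev p q) -> foldl push q p = catrev p q.
Proof.
elim: p q => //= w p IHp q redp.
suff -> : push q w = w :: q by apply: IHp.
case: q redp => [|x [|y q]] //= redp; case: eqP => // Ew; subst.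
case: (redp (rev p) y x q); by rewrite catrevE.
Qed.

Lemma reduce_reduced p : reduced p -> reduce p = rev p.
Proof. by move=> redp; apply: foldl_reduced; exact: reduced_rev. Qed.

Lemma cut_spineP p : reduced p \/ size (cut_spine p) < size p.
Proof.
elim: p => [|a [|b [|c p]] IHp] /=; try by left; case=> [|? [|? []]] ? ? ?.
case: eqVneq => [_|ac]; first by right=> /=; lia.
by case: IHp => IHp; [left; exact: reduced_cons3 | right].
Qed.

Lemma cut_spine_id p : reduced p -> cut_spine p = p.
Proof.
elim: p => [|a [|b [|c p]] IHp] //= redp.
case: eqVneq => [ac|_]; first by case: (redp [::] a b p); rewrite ac.
by congr (_ :: _); apply: IHp; exact: reduced_cons redp.
Qed.

(** Cutting a spine does not change the resulting stack, and a stack run on a reduced word only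
    reverses it; so both procedures give the same normal form once [phi p] is known to be
    reduced. *)
Lemma phiE p : phi p = rev (reduce p).
Proof.
have red_iter n : reduce (iter n (@cut_spine V) p) = reduce p.
  by elim: n => //= n <-; apply: foldl_cut_spine; case=> [|? []].
rewrite -(red_iter (size p)) -/(phi p).
suff redp : reduced (phi p) by rewrite reduce_reduced ?revK.
(* Each round on a word that is not yet reduced removes a letter, so after [size p] rounds such a
   word would be empty, hence reduced. *)
have iterP n : reduced (iter n (@cut_spine V) p) \/
    size (iter n (@cut_spine V) p) + n <= size p.
  elim: n => [|n [IHn|IHn]] /=; first by right; rewrite addn0.
    by left; rewrite cut_spine_id.
  set q := iter _ _ _ in IHn *; case: (cut_spineP q) => [redq|szq].
    by left; rewrite cut_spine_id.
  by right; rewrite addnS; apply: leq_trans IHn; rewrite -addSn leq_add2r.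
case: (iterP (size p)) => // szp; have /nilP -> : nilp (phi p).
  by move: szp; rewrite /nilp /phi; lia.
by case=> [|? []].
Qed.

End Reduction.

Arguments push {V} : simpl never.

(** * Square equivalence of walks and of their continuations *)

Section SquareEquiv.
Variables (V : finType) (e : rel V).
Hypothesis e_sym : symmetric e.
Implicit Types (p q r s u v : seq V) (a b c d w x y : V).

Lemma nonbacktrackingP p :
  nonbacktracking e p <-> [/\ p <> [::], sorted e p & reduced p].
Proof.
rewrite /nonbacktracking /walk; split.
  case/andP=> /andP[/eqP p0 ep] /forallP h; split=> // u a b v Ep.
  have /cat_sorted2[_ /= /and3P[eab eba _]]: sorted e (u ++ [:: a, b, a & v]).
    by rewrite -Ep.
  move/forallP/(_ b)/implyP: (h a).
  rewrite /spine /closed_walk /walk /= eab eba eqxx /= => /(_ isT)/negP; apply.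
  by apply/infixP; exists u, v.
case=> /eqP -> -> redp /=; apply/forallP=> a; apply/forallP=> b; apply/implyP=> _.
by apply/negP=> /infixP[u [v]]; apply: redp.
Qed.

Definition is_square a b c d :=
  [&& e a b, e b c, e c d, e d a, a != c & b != d].

Lemma squareP s :
  square e s <-> exists a b c d, s = [:: a; b; c; d; a] /\ is_square a b c d.
Proof.
rewrite /square /closed_walk /walk_length; split.
  case/and3P=> /nonbacktrackingP[_ + reds] /andP[_ /eqP].
  case: s reds => [|a [|b [|c [|d [|a' [|]]]]]] //= reds /and5P[ab bc cd da _] [Ea] _.
  subst a'; exists a, b, c, d; split=> //; rewrite /is_square ab bc cd da /=.
  apply/andP; split; apply/eqP=> E; subst.
    exact: (reds [::] c b [:: d; c]).
  exact: (reds [:: a] d c [:: a]).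
case=> a [b [c [d [-> /and5P[ab bc cd da /andP[ac bd]]]]]].
rewrite /walk /= ab bc cd da !eqxx !andbT; apply/nonbacktrackingP; split=> //=.
  by rewrite ab bc cd da.
do 3?[apply: reduced_cons3 => //]; first by rewrite eq_sym.
by case=> [|? [|? []]].
Qed.

Lemma add_squareP p q :
  add_square e p q <->
  exists u a v b c d, [/\ p = u ++ a :: v, is_square a b c d
    & q = rev (reduce (u ++ [:: a, b, c, d, a & v]))].
Proof.
split.
  case=> k [s [_ /squareP[a [b [c [d [-> sq]]]]] /= /esym pk ->]].
  exists (take k p), a, (drop k.+1 p), b, c, d; split=> //; last by rewrite phiE.
  have ltkp: k < size p by rewrite -onthTE pk.
  rewrite -{1}(cat_take_drop k p) (drop_nth a) //; congr (_ ++ _ :: _).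
  exact: onth_nth.
case=> u [a [v [b [c [d [-> sq ->]]]]]].
exists (size u), [:: a; b; c; d; a]; split.
- by rewrite /walk_length size_cat /= addnS /= leq_addr.
- by apply/squareP; exists a, b, c, d.
- by rewrite onth_cat ltnn subnn.
by rewrite -phiE /insert_cycle take_size_cat // drop_cat ltnNge leqnSn subSnn /= drop0.
Qed.

Definition stack_equiv q r := square_equiv e (rev q) (rev r).

Definition walk_stack q := [/\ q <> [::], sorted e q & reduced q].

Lemma nonbacktracking_rev q : nonbacktracking e (rev q) <-> walk_stack q.
Proof.
rewrite nonbacktrackingP /walk_stack rev_sorted.
rewrite (eq_sorted (e' := e)); last by move=> x y; rewrite e_sym.
split=> -[q0 eq redq]; split=> //.
- by move=> E; apply: q0; rewrite E.
- by rewrite -[q]revK; exact: reduced_rev.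
- by move=> /(congr1 rev); rewrite revK.
- exact: reduced_rev.
Qed.

Lemma walk_stack_push q x w :
  walk_stack q -> ohead q = Some x -> e x w -> walk_stack (push q w).
Proof.
case=> _ eq redq qx xw; split; last exact: reduced_push.
  by have:= ohead_push q w; case: push.
case: q eq qx {redq} => [//|y [|z q]] /= eq [Ey]; subst y; rewrite /push.
  by rewrite /= e_sym xw.
case: ifP => _ //=; first by case/andP: eq.
by rewrite e_sym xw.
Qed.

Lemma walk_stack_foldl q x r :
  walk_stack q -> ohead q = Some x -> path e x r ->
  walk_stack (foldl push q r) /\ ohead (foldl push q r) = Some (last x r).
Proof.
elim: r q x => [|w r IHr] q x //= wq qx /andP[xw wr].
by apply: IHr; rewrite ?ohead_push //; exact: walk_stack_push wq qx xw.
Qed.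

Lemma ohead_reduce u a v : ohead (reduce (u ++ a :: v)) = Some (last a v).
Proof.
rewrite /reduce foldl_cat /=; move: (ohead_push (foldl push [::] u) a).
move: (push _ a) => {u}q; elim: v q a => //= b v IHv q a _.
by apply: IHv; rewrite ohead_push.
Qed.

(* Makes pushing a letter well defined on vertices of the square cover. *)
Lemma add_square_push p q x w :
  reduced p -> ohead (rev p) = Some x -> e x w -> add_square e p q ->
  let p' := rev (push (rev p) w) in let q' := rev (push (rev q) w) in
  add_square e p' q' \/ add_square e q' p'.
Proof.
move=> redp px xw /add_squareP[u [a [v [b [c [d [Ep sq ->]]]]]]] /=; rewrite revK.
(* Appending [w] either lengthens [p], and the same square still fits, or cancels the last letter of
   [p]. *)
have [Ew|[P' Ep' Ew]]: push (rev p) w = w :: rev p \/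
    exists2 P', rev p = [:: x, w & P'] & push (rev p) w = w :: P'.
- case: (rev p) px => [//|y [|z P]] /= [->]; first by left.
  by rewrite /push; case: (eqVneq w z) => [->|]; [right; exists P | left].
- left; apply/add_squareP; exists u, a, (rcons v w), b, c, d; split=> //.
    by rewrite Ew rev_cons revK Ep -rcons_cons rcons_cat.
  by rewrite -!rcons_cons -rcons_cat /reduce foldl_rcons.
have {Ep'} Ep' : p = rcons (rcons (rev P') w) x by rewrite -[p]revK Ep' !rev_cons.
rewrite {}Ew rev_cons; set u' := rev P' in Ep' *.
(* If [v] is non-empty, the cancelled letter comes after the inserted square and the insertion
   survives; otherwise the square sits at the last letter [a] of [p]. *)
case: (lastP v) Ep => [|v' y] Ep; last first.
  move: Ep'; rewrite {}Ep -rcons_cons -rcons_cat => /rcons_inj[Eu _].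
  have lastw: last a v' = w by move/(congr1 (last a)): Eu; rewrite last_rcons last_cat.
  left; apply/add_squareP; exists u, a, v', b, c, d; split=> //.
  rewrite -!rcons_cons -rcons_cat /reduce foldl_rcons push_push //.
    exact: reduced_reduce.
  by rewrite ohead_reduce /= lastw.
move: Ep' redp; rewrite Ep cats1 => /rcons_inj[Eu ax]; subst u x => redp.
have redw : reduced (w :: P').
  by move: (reduced_rev redp); rewrite !rev_rcons => /reduced_cons; rewrite revK.
have Eredw : reduce (rcons u' w) = w :: P'.
  rewrite reduce_reduced ?rev_rcons ?revK //.
  by rewrite -[rcons _ _]revK rev_rcons revK; apply: reduced_rev.
pose P0 := [:: a, w & P'].
have push_wa : push (w :: P') a = P0.
  move: (reduced_rev redp); rewrite !rev_rcons /= revK -/P0.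
  move: redw; rewrite /P0; case: (P') => [//|z P''] /= _ red3.
  by rewrite /push; case: (eqVneq a z) => // Ez; case: (red3 [::] z w P''); rewrite Ez.
case/and5P: (sq) => ab bc cd da /andP[ac bd].
rewrite /reduce foldl_cat -/(reduce _) Eredw -[push (foldl _ _ _) w]foldl_rcons /=.
set W := w :: P' in Eredw redw push_wa *.
have Ww : ohead W = Some w by [].
case: (eqVneq b w) => [Eb|bw].
  subst b; left; apply/add_squareP; exists u', w, [::], c, d, a; split.
  - by rewrite cats1.
  - by rewrite /is_square bc cd da ab bd eq_sym ac.
  (* For [b = w] the spine [w a w] disappears from [q], and appending [w] closes the same square
     started at [w]. The case [d = w] below is similar: there appending [w] drops the final [a]. *)
  by rewrite -cat_rcons /reduce foldl_cat -/(reduce _) Eredw (push_push (q := W)).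
case: (eqVneq d w) => [Ed|dw].
  subst d; left; apply/add_squareP; exists u', w, [::], a, b, c; split.
  - by rewrite cats1.
  - by rewrite /is_square ab bc cd da ac eq_sym bd.
  rewrite -cat_rcons /reduce foldl_cat -/(reduce _) Eredw /=.
  by rewrite (push_push (a := w)) ?ohead_push //; do !apply: reduced_push.
(* Here [p = u' w a] loses its last letter while [q = u' w a b c d a] gains [w]:
   the reverse square, inserted at the first [a] of [q'], leads back to [p']. *)
right; apply/add_squareP.
exists (rcons u' w), a, [:: b; c; d; a; w], d, c, b; split.
- rewrite push_wa /P0 /push (negPf bw) eq_sym (negPf ac) eq_sym (negPf bd) (negPf ac).
  by rewrite eq_sym (negPf dw) /u' !rev_cons -!cats1 -!catA.
- by rewrite /is_square (e_sym a d) (e_sym d c) (e_sym c b) (e_sym b a) da cd bc ab ac eq_sym bd.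
rewrite /reduce foldl_cat -/(reduce _) Eredw.
by rewrite (foldl_cancel [:: a; d; c; b; a] redw Ww) /W rev_cons.
Qed.

Lemma square_equiv_ends p q : square_equiv e p q ->
  ohead (rev p) = ohead (rev q) /\ (nonbacktracking e p <-> nonbacktracking e q).
Proof.
have last_eq p' q' : add_square e p' q' -> ohead (rev p') = ohead (rev q').
  case/add_squareP=> u [a [v [b [c [d [-> _ ->]]]]]].
  rewrite revK ohead_reduce rev_cat rev_cons; case/lastP: v => [|v x] //=.
  by rewrite rev_rcons last_rcons.
elim=> {p q} [p q [nbp nbq]|p|p q _ [-> ->]|p q r _ [-> ->] _ [-> ->]] //.
by case=> /last_eq ->.
Qed.

Lemma square_equiv_push p q x w :
  square_equiv e p q -> nonbacktracking e p -> ohead (rev p) = Some x -> e x w ->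
  square_equiv e (rev (push (rev p) w)) (rev (push (rev q) w)).
Proof.
move=> + + + xw.
have step p' q' : nonbacktracking e p' -> nonbacktracking e q' ->
    ohead (rev p') = Some x -> ohead (rev q') = Some x ->
    add_square e p' q' -> square_equiv e (rev (push (rev p') w)) (rev (push (rev q') w)).
  move=> nbp nbq px qx pq; have redp : reduced p' by case/nonbacktrackingP: nbp.
  apply: rst_step; split; try apply/nonbacktracking_rev.
  - by apply: walk_stack_push px xw; apply/nonbacktracking_rev; rewrite revK.
  - by apply: walk_stack_push qx xw; apply/nonbacktracking_rev; rewrite revK.
  exact: (add_square_push redp px xw pq).
elim=> {p q} [p q pq|p|p q pq IH|p q r pq IHpq qr IHqr] nbp px.
- have [pqx _] := square_equiv_ends (@rst_step _ _ _ _ pq).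
  have qx : ohead (rev q) = Some x by rewrite -pqx.
  case: pq => _ nbq [/step|/step] H; first exact: H.
  by apply: rst_sym; apply: H.
- exact: rst_refl.
- have [pqx nbpq] := square_equiv_ends pq.
  by apply: rst_sym; apply: IH; [apply/nbpq | rewrite pqx].
have [pqx nbpq] := square_equiv_ends pq.
apply: rst_trans (IHpq nbp px) (IHqr _ _); first exact/nbpq.
by rewrite -pqx.
Qed.

Lemma stack_equiv_foldl q q' x r :
  stack_equiv q q' -> walk_stack q -> ohead q = Some x -> path e x r ->
  stack_equiv (foldl push q r) (foldl push q' r).
Proof.
elim: r q q' x => //= w r IHr q q' x qq' wq qx /andP[xw wr].
apply: (IHr _ _ w) => //; last exact: ohead_push.
  have := square_equiv_push qq'; rewrite /stack_equiv !revK; apply; [|exact: qx|done].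
  exact/nonbacktracking_rev.
exact: walk_stack_push wq qx xw.
Qed.

(* The words [r] and [s] are continuations of a walk ending in [a]. *)
Definition word_equiv a r s :=
  [/\ path e a r, path e a s, last a r = last a s &
   forall q, walk_stack q -> ohead q = Some a ->
     stack_equiv (foldl push q r) (foldl push q s)].

Lemma word_equiv_refl a r : path e a r -> word_equiv a r r.
Proof. by move=> ar; split=> // q _ _; apply: rst_refl. Qed.

Lemma word_equiv_sym a r s : word_equiv a r s -> word_equiv a s r.
Proof. by case=> ar as' l H; split=> // q wq qa; apply: rst_sym; apply: H. Qed.

Lemma word_equiv_trans a r s t :
  word_equiv a r s -> word_equiv a s t -> word_equiv a r t.
Proof.
case=> ar _ l1 H1 [_ at' l2 H2]; split=> //; first by rewrite l1.
by move=> q wq qa; apply: rst_trans (H1 q wq qa) (H2 q wq qa).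
Qed.

Lemma word_equiv_cat a r s r' s' :
  word_equiv a r s -> word_equiv (last a r) r' s' ->
  word_equiv a (r ++ r') (s ++ s').
Proof.
case=> ar as' l H [ar' as'' l' H']; split.
- by rewrite cat_path ar.
- by rewrite cat_path as' -l.
- by rewrite !last_cat -l.
move=> q wq qa; rewrite !foldl_cat.
have [wr rx] := walk_stack_foldl wq qa ar.
apply: rst_trans (H' _ wr rx) _.
apply: (stack_equiv_foldl (H q wq qa) wr rx); exact: as''.
Qed.

Lemma word_equiv_spine x y : e x y -> word_equiv x [:: y; x] [::].
Proof.
move=> xy; split=> //=; first by rewrite xy e_sym xy.
by move=> q [_ _ redq] qx; rewrite push_push //; apply: rst_refl.
Qed.

(** Two sides of a quadrilateral may be exchanged for the other two. If it is a genuine square,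
    insert [x y z t x] at the end of the walk and continue along [t z]: this undoes the last two
    sides and leaves [y z]. If [x = z] both words cancel, and if [y = t] they coincide. *)
Lemma word_equiv_square x y z t :
  e x y -> e y z -> e x t -> e t z -> word_equiv x [:: y; z] [:: t; z].
Proof.
move=> xy yz xt tz; split=> //=; rewrite ?xy ?yz ?xt ?tz // => q wq qx.
case: (eqVneq x z) => [<-|xz]; first by case: wq => _ _ ?; rewrite !push_push //; apply: rst_refl.
case: (eqVneq y t) => [->|yt]; first exact: rst_refl.
have sq : is_square x y z t by rewrite /is_square xy yz xz yt e_sym tz e_sym xt.
have pr : path e x [:: y; z; t; x] by rewrite /= xy yz (e_sym z) tz (e_sym t) xt.
have [wr rx] := walk_stack_foldl wq qx pr.
have qsq : stack_equiv q (foldl push q [:: y; z; t; x]).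
  case: q qx wq wr {rx} => // _ q [->] wq wr.
  apply: rst_step; split; try exact/nonbacktracking_rev.
  left; apply/add_squareP; exists (rev q), x, [::], y, z, t; split=> //.
    by rewrite cats1 rev_cons.
  rewrite -cat_rcons -rev_cons /reduce foldl_cat -/(reduce _) reduce_reduced ?revK //.
  by apply: reduced_rev; case: wq.
have ptz : path e x [:: t; z] by rewrite /= xt tz.
have := stack_equiv_foldl qsq wq qx ptz; rewrite -foldl_cat => H.
apply: rst_sym; apply: rst_trans H _.
rewrite (foldl_cat _ _ [:: y; z]) (foldl_cancel [:: t; x] (a := z)) //; last first.
- by rewrite /= ohead_push.
- by do 2!apply: reduced_push; case: wq.
exact: rst_refl.
Qed.

(** The letter [f 0] is left out: these words continue a walk that already ends in it. *)
Definition row (f : nat -> V) m := mkseq (fun i => f i.+1) m.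

Lemma rowS f m : row f m.+1 = row f m ++ [:: f m.+1].
Proof. by rewrite /row mkseqS cats1. Qed.

Lemma last_row f m : last (f 0) (row f m) = f m.
Proof. by case: m => // m; rewrite rowS last_cat. Qed.

Lemma row_path f m : (forall i, i < m -> e (f i) (f i.+1)) -> path e (f 0) (row f m).
Proof.
elim: m => // m IHm ef; rewrite rowS cat_path last_row /= ef // IHm //.
by move=> i im; apply: ef; exact: ltnW.
Qed.

(** Every second letter closes a spine, so only the parity of [m] survives. *)
Lemma row_alternating f m x y : e x y ->
  (forall i, i <= m -> f i = if odd i then y else x) ->
  word_equiv x (row f m) (if odd m then [:: y] else [::]).
Proof.
move=> xy; elim: m => [|m IHm] fE; first exact: word_equiv_refl.
have IH := IHm (fun i im => fE i (leqW im)).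
have lastm : last x (row f m) = f m by rewrite -(last_row f) (fE 0).
have step : e (f m) (f m.+1).
  by rewrite !fE //=; case: odd; rewrite //= e_sym.
have: word_equiv x (row f m ++ [:: f m.+1]) ((if odd m then [:: y] else [::]) ++ [:: f m.+1]).
  by apply: word_equiv_cat IH _; apply: word_equiv_refl; rewrite /= lastm step.
rewrite -rowS (fE m.+1) //=.
case: odd => //= H; exact: word_equiv_trans H (word_equiv_spine xy).
Qed.

Definition grid (h : nat -> nat -> V) :=
  forall i j, e (h i j) (h i.+1 j) /\ e (h i j) (h i j.+1).

(** The detour through the next row starts as a spine, down and up; exchanging the sides of one unit
    square at a time carries its upward step to the right. *)
Lemma row_down h m : grid h ->
  word_equiv (h 0 0) (row (h^~ 0) m) (h 0 1 :: row (h^~ 1) m ++ [:: h m 0]).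
Proof.
move=> hh; have hx i j := (hh i j).1; have hy i j := (hh i j).2.
elim: m => [|m IHm]; first exact/word_equiv_sym/word_equiv_spine.
have lastm : last (h 0 0) (row (h^~ 0) m) = h m 0 by rewrite (last_row (h^~ 0)).
rewrite rowS; apply: word_equiv_trans (word_equiv_cat IHm (word_equiv_refl _)) _.
  by rewrite lastm /= hx.
rewrite rowS -!cat_cons -!catA; apply: word_equiv_cat.
  apply: word_equiv_refl; rewrite /= hy; exact: (row_path (f := h^~ 1)).
rewrite /= (last_row (h^~ 1)); apply: word_equiv_square => //; by rewrite e_sym.
Qed.

(** The words [u] and [v] run down the left side and up the right side of the rectangle. *)
Lemma row_descent h m g : grid h ->
  exists u v, [/\ size u = g, size v = g, last (h 0 0) u = h 0 g &
    word_equiv (h 0 0) (row (h^~ 0) m) (u ++ row (h^~ g) m ++ v)].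
Proof.
elim: g h => [|g IHg] h hh.
  exists [::], [::]; split=> //; rewrite cats0; apply: word_equiv_refl.
  by apply: (row_path (f := h^~ 0)) => i _; case: (hh i 0).
have [|u [v [ug vg lu H]]] := IHg (fun i j => h i j.+1); first by move=> i j; exact: hh.
exists (h 0 1 :: u), (v ++ [:: h m 0]); split=> //=; first by rewrite ug.
  by rewrite size_cat vg addn1.
apply: word_equiv_trans (row_down m hh) _; rewrite -cat1s -[h 0 1 :: u ++ _]cat1s.
apply: word_equiv_cat; first by apply: word_equiv_refl; rewrite /= (hh 0 0).2.
rewrite (catA _ v) (catA u); apply: word_equiv_cat; first exact: H.
apply: word_equiv_refl; rewrite /= (last_row (h^~ 1)) andbT e_sym.
by case: (hh m 0).
Qed.

(* Descending [g] rows turns the top row into the bottom one, which collapses to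
   at most one letter. *)
Lemma row_shortcut h m g x y : grid h -> e x y ->
  (forall i, i <= m -> h i g = if odd i then y else x) ->
  exists2 t, size t <= g.*2.+1 & word_equiv (h 0 0) (row (h^~ 0) m) t.
Proof.
move=> hh xy hg; have [u [v [ug vg lu H]]] := row_descent m g hh.
have alt := row_alternating xy hg.
exists (u ++ (if odd m then [:: y] else [::]) ++ v).
  by rewrite !size_cat ug vg; case: odd => /=; lia.
apply: (word_equiv_trans H).
case: H => _; rewrite !cat_path lu hg // => /and3P[pu pg pv] _ _.
apply: word_equiv_cat; first exact: word_equiv_refl.
rewrite lu hg //; apply: word_equiv_cat => //; exact: word_equiv_refl.
Qed.

(** There are finitely many words of length at most [m], so some class of the infinite cover is
    reached by none of them. Take a shortest word reaching it: its prefix of length [m] has no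
    shorter equivalent, since replacing the prefix would shorten the whole word. *)
Lemma long_word a : infinite_graph (square_cover e a) ->
  forall m, exists s, [/\ path e a s, size s = m &
    forall t, word_equiv a s t -> m <= size t].
Proof.
move=> inf m.
have wa : walk_stack [:: a] by split=> // -[|? [|? []]].
have [p nbp [pa far]] : exists2 p, nonbacktracking e p & ohead p = Some a /\
    forall t, path e a t -> size t <= m -> ~ stack_equiv (foldl push [:: a] t) (rev p).
  apply: contra_notP inf => near.
  pose F (t : {bseq m of V}) := [set q | square_equiv e (rev (foldl push [:: a] t)) q]%classic.
  apply: (@sub_finite_set _ _ (F @` setT)%classic); last exact/finite_image/finite_finset.
  move=> _ [p [nbp pa] ->] /=.
  have [t [at_ tm tp]] : exists t, [/\ path e a t, size t <= m &
      stack_equiv (foldl push [:: a] t) (rev p)].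
    apply: contra_notP near => notp; exists p => //; split=> // t at_ tm tp.
    by apply: notp; exists t.
  exists (Bseq tm) => //; apply/seteqP; rewrite /F; rewrite /stack_equiv revK in tp.
  by split=> q; apply: rst_trans => //; exact: rst_sym.
case: p nbp pa far => // b r nbp [Eb]; subst b; set p := a :: r => far.
pose P n := `[< exists s, [/\ path e a s, size s = n &
  stack_equiv (foldl push [:: a] s) (rev p)] >].
have exP : exists n, P n.
  have [_ ar redr] := (nonbacktrackingP (a :: r)).1 nbp.
  exists (size r); apply/asboolP; exists r; split=> //.
  by rewrite -(reduce_reduced redr); exact: rst_refl.
case: (ex_minnP exP) => n /asboolP[s [as_ sn sp]] minn.
have mn : m < n.
  by rewrite ltnNge; apply/negP=> nm; apply: (far s); rewrite ?sn.
move: as_; rewrite -{1}(cat_take_drop m s) cat_path => /andP[as1 as2].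
have [w1 x1] := walk_stack_foldl wa erefl as1.
exists (take m s); split=> //; first by rewrite size_takel // sn ltnW.
move=> t [_ at_ lt H]; rewrite -(leq_add2r (n - m)).
rewrite addnC subnK; last exact: ltnW.
rewrite -{2}sn -size_drop -size_cat; apply: minn; apply/asboolP.
exists (t ++ drop m s); split=> //; first by rewrite cat_path at_ -lt.
apply: rst_trans sp; rewrite -{2}(cat_take_drop m s) !foldl_cat; apply: rst_sym.
exact: stack_equiv_foldl (H _ wa erefl) w1 x1 as2.
Qed.

End SquareEquiv.

(** * Folding the plane and gluing blocks at linear distance *)

Section Gluing.
Variables (V : finType) (e : rel V).
Hypothesis e_sym : symmetric e.
Local Open Scope ring_scope.
Implicit Types (x y z : int * int -> V) (u v : int * int) (i j t c d : int).

Lemma pair_ext u v : u.1 = v.1 -> u.2 = v.2 -> u = v.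
Proof. by case: u v => [? ?] [? ?] /= -> ->. Qed.

Lemma hom_shiftP x :
  (forall i j, e (x (i, j)) (x (i + 1, j)) /\ e (x (i, j)) (x (i, j + 1))) ->
  hom_shift e x.
Proof.
move=> h [i j] [i' j'] /=; rewrite /norm1 /= => uv.
have [[E1 E2]|[[E1 E2]|[[E1 E2]|[E1 E2]]]] :
  (i = i' + 1 /\ j = j') \/ (i' = i + 1 /\ j = j') \/
  (i = i' /\ j = j' + 1) \/ (i = i' /\ j' = j + 1) by lia.
- by rewrite E1 E2 e_sym; case: (h i' j').
- by rewrite E1 E2; case: (h i j').
- by rewrite E1 E2 e_sym; case: (h i' j').
- by rewrite E1 E2; case: (h i' j).
Qed.

Lemma hom_shift_comp x (f : int * int -> int * int) :
  (forall u v, norm1 (u - v) = 1%N -> norm1 (f u - f v) = 1%N) ->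
  hom_shift e x -> hom_shift e (x \o f).
Proof. by move=> hf hx u v /hf /hx. Qed.

Lemma hom_shift_translate x u : hom_shift e x -> hom_shift e (fun v => x (v + u)).
Proof.
apply: hom_shift_comp => -[i j] [i' j']; case: u => k l; rewrite /norm1 /=; lia.
Qed.

Definition par i : int := (i %% 2)%Z.

(** For [n >= 1] this is the identity from [0] to [n]; beyond either end it alternates between the
    end point and its inner neighbour, so that neighbours stay neighbours. *)
Definition clamp (n j : int) : int := Num.max (Num.min j (n - par (j - n))) (par j).

(* Identity up to column [n]; each further column folds the picture once more,
   until after [n] columns only the points [(n, 0)] and [(n, 1)] remain. *)
Definition squeeze (n : int) u : int * int :=
  let m := Num.max (u.1 - n) 0 in
  (u.1 - m, Num.max (clamp n u.2 - m) (par (u.2 + m))).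

Lemma hom_shift_squeeze (n : int) x :
  1 <= n -> hom_shift e x -> hom_shift e (x \o squeeze n).
Proof.
move=> n1 hx; apply: hom_shiftP => i j; split; apply: hx;
  rewrite /squeeze /clamp /par /norm1 /=; lia.
Qed.

Definition checker (a b : V) i : V := if par i == 0 then a else b.

Lemma checker_shift a b d : e a b ->
  exists a' b', e a' b' /\ forall i, checker a b (i + d) = checker a' b' i.
Proof.
move=> ab; case: (eqVneq (par d) 0) => pd.
  exists a, b; split=> // i; congr (if _ then _ else _).
  by move: pd; rewrite /par; lia.
exists b, a; split=> [|i]; first by rewrite e_sym.
rewrite /checker (_ : (par (i + d) == 0) = (par i != 0)); last first.
  by move: pd; rewrite /par; lia.
by case: (par i == 0).
Qed.

Definition in_box (n : int) u := [&& 0 <= u.1, u.1 < n, 0 <= u.2 & u.2 < n].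

Lemma checkered_right (n : int) x u : 1 <= n -> hom_shift e x ->
  exists y a b, [/\ hom_shift e y, e a b,
    forall v, in_box n v -> y (u + v) = x v &
    forall t j, 0 <= t -> y (u.1 + 2 * n + t, j) = checker a b (t + j)].
Proof.
move=> n1 hx; pose y := x \o squeeze n; have hy := hom_shift_squeeze n1 hx.
(* At column [2 * n + t] the folding leaves only the point [(n, par (j + n + t))]. The shift by
   [- u.2] below accounts for the height of the block. *)
have xab : e (x (n, par n)) (x (n, par (n + 1))).
  by apply: hx; rewrite /norm1 /par /=; lia.
have [a [b [ab E]]] := checker_shift (- u.2) xab.
exists (fun v => y (v + - u)), a, b; split=> //.
- exact: hom_shift_translate.
- move=> [k l]; rewrite /in_box /= => box; rewrite addrAC subrr add0r /y /=.
  by congr (x _); rewrite /squeeze /clamp /par /=; congr (_, _); lia.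
move=> t j t0; rewrite -E /checker /y /=; case: u E => k l _ /=.
case: eqP => tj; congr (x _); rewrite /squeeze /clamp /par /=; congr (_, _);
  move: tj; rewrite /par; lia.
Qed.

Lemma checkered_left (n : int) x u : 1 <= n -> hom_shift e x ->
  exists y a b, [/\ hom_shift e y, e a b,
    forall v, in_box n v -> y (u + v) = x v &
    forall t j, 0 <= t -> y (u.1 - n - 1 - t, j) = checker a b (t + j)].
Proof.
(* The reflection [mir] preserves the block at the origin and takes column [u.1 - n - 1 - t] to
   column [- u.1 + 2 * n + t]. *)
move=> n1 hx; pose mir v : int * int := (n - 1 - v.1, v.2).
have hmir w : hom_shift e w -> hom_shift e (w \o mir).
  by apply: hom_shift_comp => -[k l] [k' l']; rewrite /norm1 /=; lia.
have [y [a [b [hy ab yx yc]]]] := checkered_right (- u.1, u.2) n1 (hmir _ hx).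
exists (y \o mir), a, b; split=> //; first exact: hmir.
  move=> [k l] box; have -> : x (k, l) = (x \o mir) (mir (k, l)).
    by rewrite /mir /=; congr (x _); congr (_, _); lia.
  rewrite -yx; last by move: box; rewrite /in_box /=; lia.
  by congr (y _); apply: pair_ext => /=; lia.
by move=> t j t0; rewrite -yc // /mir /=; congr (y _); congr (_, _); lia.
Qed.

(** The strip between the two checkerboards carries the walk [a b s b'], read along every row and
    one letter ahead on odd rows. Its extreme columns then agree with the checkerboards, and
    neighbouring points carry consecutive letters. *)
Lemma glue_checkered y y' a b a' b' c (s : seq V) :
  hom_shift e y -> hom_shift e y' -> e a b -> e a' b' ->
  (forall t j, 0 <= t -> y (c + t, j) = checker a b (t + j)) ->
  (forall t j, 0 <= t -> y' (c + (size s).+1%:Z - t, j) = checker a' b' (t + j)) ->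
  path e b s -> last b s = a' ->
  exists z, [/\ hom_shift e z, forall i j, i <= c -> z (i, j) = y (i, j) &
    forall i j, c + (size s).+1%:Z <= i -> z (i, j) = y' (i, j)].
Proof.
move=> hy hy' ab ab' yc yc' bs lasts; set c' := c + _ in yc' *.
pose w k := nth a (a :: b :: rcons s b') k.
have w_step k l : (k <= (size s).+2)%N -> (l <= (size s).+2)%N -> 
    (k = l.+1 \/ l = k.+1) -> e (w k) (w l).
  have pw : path e a (b :: rcons s b') by rewrite /= ab rcons_path bs lasts.
  move=> kL lL [El|El]; subst; last first.
    by apply: (pathP a pw); rewrite /= size_rcons.
  by rewrite e_sym; apply: (pathP a pw); rewrite /= size_rcons.
pose z u := if u.1 <= c then y u else if c' <= u.1 then y' u else w (absz (u.1 - c + par u.2)).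
have zmid i j : c <= i <= c' -> z (i, j) = w (absz (i - c + par j)).
  rewrite /z /=; case: ifP => ic.
    move=> ci; have {ci} -> : i = c by lia.
    rewrite -[c in LHS]addr0 yc // /checker add0r subrr add0r /par.
    case: eqP => [-> //|pj]; have -> : absz (j %% 2)%Z = 1%N by lia.
    by [].
  case: ifP => c'i // ci; have {ci} -> : i = c' by lia.
  rewrite -[c' in LHS]subr0 yc' // /checker add0r /c' (addrC c) addrK /par.
  case: eqP => [->|pj].
    rewrite addr0 /w /= -rcons_cons nth_rcons /= ltnSn.
    by rewrite -lasts nth_last.
  have -> : absz ((size s).+1%:Z + (j %% 2)%Z) = (size s).+2 by lia.
  by rewrite /w /= nth_rcons ltnn eqxx.
exists z; split; last 2 first.
- by move=> i j ic; rewrite /z /= ic.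
- by move=> i j ic; rewrite /z /= ic; case: ifP => // ci; exfalso; lia.
have z1 i j : i <= c -> z (i, j) = y (i, j) by move=> ic; rewrite /z /= ic.
have z2 i j : c' <= i -> z (i, j) = y' (i, j).
  by move=> ic; rewrite /z /= ic; case: ifP => // ci; exfalso; lia.
apply: hom_shiftP => i j; split.
  case: (leP (i + 1) c) => ic.
    by rewrite !z1; [apply: hy; rewrite /norm1 /=; lia| |]; lia.
  case: (leP c' i) => ci.
    by rewrite !z2; [apply: hy'; rewrite /norm1 /=; lia| |]; lia.
  by rewrite !zmid; [apply: w_step; rewrite /par| |]; lia.
case: (leP i c) => ic; first by rewrite !z1 //; apply: hy; rewrite /norm1 /=; lia.
case: (leP c' i) => ci; first by rewrite !z2 //; apply: hy'; rewrite /norm1 /=; lia.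
by rewrite !zmid; [apply: w_step; rewrite /par| |]; lia.
Qed.

(** With [k = 1] there is no parity obstruction; [k = 2] tolerates one. *)
Definition has_walks (k N : nat) := forall a b m, (N <= m)%N ->
  exists r s, [/\ (r < k)%N, path e a s, size s = (m + r)%N & last a s = b].

Definition glues (k n : nat) u u' := forall x x', hom_shift e x -> hom_shift e x' ->
  exists z v, [/\ hom_shift e z, (norm_inf v < k)%N,
    forall w, in_box n%:Z w -> z (u + w) = x w &
    forall w, in_box n%:Z w -> z (u' + v + w) = x' w].

(** Translating the glued configuration transfers the displacement [v] from one block to the
    other. *)
Lemma glues_sym k n u u' : glues k n u u' -> glues k n u' u.
Proof.
move=> H x x' hx hx'; have [z [v [hz vk zu zu']]] := H x' x hx' hx.
exists (fun w => z (w + v)), (- v); split.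
- exact: hom_shift_translate.
- by move: vk; case: v {zu'} => v1 v2; rewrite /norm_inf /=; lia.
- by move=> w bw; rewrite -zu' // addrAC.
by move=> w bw; rewrite -zu //; congr z; rewrite addrAC subrK.
Qed.

Lemma glues_swap k n u u' : glues k n (u.2, u.1) (u'.2, u'.1) -> glues k n u u'.
Proof.
pose swap u : int * int := (u.2, u.1).
have hswap x : hom_shift e x -> hom_shift e (x \o swap).
  by apply: hom_shift_comp => -[k' l] [k'' l']; rewrite /norm1 /=; lia.
move=> H x x' hx hx'; have [z [v [hz vk zu zu']]] := H _ _ (hswap _ hx) (hswap _ hx').
exists (z \o swap), (swap v); split; first exact: hswap.
- by move: vk; rewrite /norm_inf /= maxnC.
- by move=> [i j] bw; apply: (zu (j, i)); move: bw; rewrite /in_box /=; lia.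
- by move=> [i j] bw; apply: (zu' (j, i)); move: bw; rewrite /in_box /=; lia.
Qed.

Lemma glues_right k N n u u' : (0 < n)%N -> has_walks k N ->
  u.1 + (3 * n + N + 2)%:Z <= u'.1 -> glues k n u u'.
Proof.
case: u => u1 u2; case: u' => u1' u2' /= n0 hN uu' x x' hx hx'.
have n1 : 1 <= n%:Z by lia.
have [y [a [b [hy ab yx /= yc]]]] := checkered_right (u1, u2) n1 hx.
have [y' [a' [b' [hy' ab' yx' /= yc']]]] := checkered_left (u1', u2') n1 hx'.
(* The checkerboards bound columns [u1 + 2 * n] and [u1' - n - 1], and a connecting walk must have
   length [m]; the assumed distance ensures [N <= m]. The [r] surplus steps of the walk are absorbed
   by moving the right block by [r]. *)
have [m Em] : exists m : nat, u1 + 2 * n%:Z + (m.+1)%:Z = u1' - n%:Z - 1.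
  by exists (absz (u1' - n%:Z - 1 - (u1 + 2 * n%:Z) - 1)%R); lia.
have [|r [s [rk bs sm lasts]]] := hN b a' m; first by lia.
pose v : int * int := (r%:Z, 0).
have [|z [hz zy zy']] := glue_checkered hy (hom_shift_translate (- v) hy') ab ab' yc _ bs lasts.
  move=> t j t0; rewrite -yc' // -Em sm; congr y'; by apply: pair_ext => /=; lia.
exists z, v; split=> //.
  move=> [i j] bw; rewrite -yx //.
  by apply: zy; move: bw; rewrite /in_box /=; lia.
move=> [i j] bw; rewrite -yx' // zy'; last by move: bw; rewrite /in_box /= sm; lia.
by congr y'; apply: pair_ext => /=; lia.
Qed.

Lemma glues_far k N n u u' : (0 < n)%N -> has_walks k N ->
  (3 * n + N + 2 <= norm_inf (u - u')%R)%N -> glues k n u u'.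
Proof.
move=> n0 hN; case: u => u1 u2; case: u' => u1' u2'; rewrite /norm_inf /= => far.
have horiz (v1 v2 w1 w2 : int) : (3 * n + N + 2 <= absz (v1 - w1)%R)%N ->
    glues k n (v1, v2) (w1, w2).
  move=> vw; have [wv|wv] := leP v1 w1.
    by apply: glues_right n0 hN _; rewrite /=; lia.
  by apply: glues_sym; apply: glues_right n0 hN _; rewrite /=; lia.
move: far; rewrite leq_max => /orP[] /horiz; first exact.
by move=> H; apply: glues_swap; apply: H.
Qed.

Lemma block_dist_le n u u' : (block_dist n u u' <= norm_inf (u - u')%R)%N.
Proof. by rewrite -leEnat; exact: bigmin_le_id. Qed.

Lemma block_dist_ge n u u' m : (m <= norm_inf (u - u')%R)%N ->
  (forall i j : 'I_n * 'I_n,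
     m <= norm_inf (block_point u i - block_point u' j)%R)%N ->
  (m <= block_dist n u u')%N.
Proof.
by move=> m0 mij; rewrite -leEnat; apply/bigmin_geP; split=> // -[i j] _; apply: mij.
Qed.

Lemma in_box_ord n (i : 'I_n * 'I_n) : in_box n%:Z (i.1%:Z, i.2%:Z).
Proof. by case: i => i j; rewrite /in_box /= !ltz_nat !ltn_ord. Qed.

Lemma phased_block_gluing_linear k N : has_walks k N ->
  phased_block_gluing (hom_shift e) (fun n => 3 * n + N + 2)%N k.
Proof.
move=> hN n n0 p p' [x [w [hx px]]] [x' [w' [hx' px']]] u u' far.
have [z [v [hz vk zu zu']]] := glues_far n0 hN (leq_trans far (block_dist_le n u u'))
  (hom_shift_translate w hx) (hom_shift_translate w' hx').
exists z, v; split=> // i; rewrite -?px -?px' /block_point ?zu ?zu' ?in_box_ord //.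
  by rewrite addrC.
by rewrite addrC.
Qed.

(** * Walks of prescribed length, from gluing and from connectedness *)

Definition has_neighbors := forall a, exists b, e a b.

Lemma checkerboard a b : e a b -> hom_shift e (fun u => checker a b (u.1 + u.2)).
Proof.
move=> ab; apply: hom_shiftP => i j; rewrite /= addrA.
suff: e (checker a b (i + j)) (checker a b (i + j + 1)).
  by rewrite -addrA (addrC j) addrA.
rewrite /checker; case: eqP => ij; case: eqP => // ij1; rewrite 1?e_sym //;
  by move: ij ij1; rewrite /par; lia.
Qed.

Definition const_block (a : V) n : block_pattern V n := [ffun=> a].

Lemma admissible1 a : has_neighbors ->
  globally_admissible (hom_shift e) (const_block a 1).
Proof.
move=> nbr; have [b ab] := nbr a.
exists (fun u => checker a b (u.1 + u.2)), 0; split; first exact: checkerboard.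
by case=> i j; rewrite ffunE /= !ord1.
Qed.

Lemma hom_shift_row x i j m : hom_shift e x ->
  path e (x (i, j)) (mkseq (fun k => x (i + k.+1%:Z, j)) m) /\
  last (x (i, j)) (mkseq (fun k => x (i + k.+1%:Z, j)) m) = x (i + m%:Z, j).
Proof.
move=> hx; elim: m => [|m [pm lm]]; first by rewrite addr0.
rewrite mkseqS rcons_path last_rcons pm lm; split=> //=.
by apply: hx; rewrite /norm1 /=; lia.
Qed.

(** For [k = 1] the displacement vanishes: gluing the letters [a] and [b] at distance [m] on a row
    leaves a walk of length exactly [m] between them. *)
Lemma phased1_has_walks f : has_neighbors ->
  phased_block_gluing (hom_shift e) f 1 -> has_walks 1 (f 1%N).
Proof.
move=> nbr gl a b m fm.
have [|x [v [hx v0 xa xb]]] := gl 1%N isT _ _ (admissible1 a nbr) (admissible1 b nbr)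
    0 (m%:Z, 0).
  apply: leq_trans fm _; apply: block_dist_ge; first by rewrite /norm_inf /=; lia.
  move=> [i1 i2] [j1 j2]; rewrite /block_point /norm_inf /= !ord1 /=; lia.
have {v0} v0 : v = 0.
  by case: v v0 {xb} => v1 v2; rewrite /norm_inf /= => ?; congr (_, _); lia.
have [px lx] := hom_shift_row 0 0 m hx.
have x0 : x (0, 0) = a.
  by move: (xa (ord0, ord0)); rewrite ffunE /block_point /=.
have xm : x (m%:Z, 0) = b.
  by move: (xb (ord0, ord0)); rewrite ffunE /block_point v0 /= !addr0.
rewrite x0 in px lx; rewrite add0r xm in lx.
by eexists 0%N, _; split; [|exact: px|rewrite size_mkseq addn0|exact: lx].
Qed.

(** A simple path has fewer than [#|V|] steps, and spines at its end lengthen it by two each; [r]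
    corrects the parity. *)
Lemma connect_has_walks : (forall a b, connect e a b) -> has_neighbors ->
  has_walks 2 #|V|.
Proof.
move=> conn nbr a b m Vm; have /connectP[s + Eb] := conn a b.
rewrite {}Eb => /shortenP[{}s as_ us _].
have [c bc] := nbr (last a s).
have szs : (size s < #|V|)%N by rewrite -[(size s).+1]/(size (a :: s)) -(card_uniqP us) max_card.
have ext n : exists r, [/\ path e a (s ++ r), size r = n.*2 & last a (s ++ r) = last a s].
  elim: n => [|n [r [pt st lt]]]; first by exists [::]; rewrite cats0.
  exists (r ++ [:: c; last a s]); split.
  - by rewrite catA cat_path pt lt /= bc e_sym bc.
  - by rewrite size_cat st addn2 doubleS.
  by rewrite catA last_cat.
have [r [pt st lt]] := ext (uphalf (m - size s)).
exists (odd (m - size s)), (s ++ r); split=> //; first by case: odd.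
rewrite size_cat st uphalf_half doubleD; have := odd_double_half (m - size s).
by move: szs Vm; case: (odd _); rewrite -!addnn /=; set h := half _; lia.
Qed.

End Gluing.

(** * Linear lower bound from long walks in the square cover *)

Section LowerBound.
Variables (V : finType) (e : rel V).
Hypothesis e_sym : symmetric e.
Local Open Scope ring_scope.

(** The walk is extended by oscillating on its first and last edges, then made constant along
    antidiagonals. *)
Lemma path_configuration (a : V) (s : seq V) : path e a s -> (0 < size s)%N ->
  exists2 x, hom_shift e x & forall i : nat, (i <= size s)%N -> x (i%:Z, 0) = nth a (a :: s) i.
Proof.
move=> as_ s0; pose w i := nth a (a :: s) (absz (clamp (size s)%:Z i)).
have w_step i : e (w i) (w (i + 1)).
  have lt_step (k : nat) : (k < size s)%N -> e (nth a (a :: s) k) (nth a (a :: s) k.+1).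
    exact: (pathP a as_).
  have [[k1 k2]|[k1 k2]] :
      (absz (clamp (size s)%:Z (i + 1)) = (absz (clamp (size s)%:Z i)).+1 /\
        (absz (clamp (size s)%:Z i) < size s)%N) \/
      (absz (clamp (size s)%:Z i) = (absz (clamp (size s)%:Z (i + 1))).+1 /\
        (absz (clamp (size s)%:Z (i + 1)) < size s)%N).
    by rewrite /clamp /par; lia.
  - by rewrite /w k1; apply: lt_step.
  - by rewrite /w k1 e_sym; apply: lt_step.
exists (fun u => w (u.1 + u.2)) => [|i si].
  apply: hom_shiftP => // i j /=.
  by split; [rewrite addrAC | rewrite addrA]; exact: w_step.
by rewrite /w /= addr0; congr nth; rewrite /clamp /par; lia.
Qed.

Lemma gap_lower_bound (a : V) (f : nat -> nat) (k n : nat) :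
  infinite_graph (square_cover e a) -> (k <= 2)%N ->
  phased_block_gluing (hom_shift e) f k -> (0 < n)%N ->
  (n <= 2 * f n + 8)%N.
Proof.
move=> inf k2 gl n0; case: (leqP n 3) => n3; first by lia.
have [s [as_ sm far]] := long_word e_sym inf (n - 3)%N.
have [|x hx xs] := path_configuration as_; first by lia.
have [b ab] : exists b, e a b by case: s as_ sm {far xs} => [|b s] /=; [lia | case/andP; exists b].
(* The walk occupies columns [1] to [n - 2] of the upper block, so it still lies above the lower
   block when that one moves sideways by one unit. *)
pose x' (u : int * int) := x (u + (- 1, 0)).
pose p : block_pattern V n := [ffun i => x' (block_point 0 i)].
pose p' : block_pattern V n := [ffun i : 'I_n * 'I_n => checker a b (i.1%:Z + i.2%:Z)].
have adm : globally_admissible (hom_shift e) p.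
  exists x', 0; split; first exact: hom_shift_translate.
  by move=> i; rewrite ffunE.
have adm' : globally_admissible (hom_shift e) p'.
  exists (fun u => checker a b (u.1 + u.2)), 0; split; first exact: checkerboard.
  by move=> i; rewrite ffunE /block_point add0r.
have [|z [v [hz vk zp zp']]] := gl n n0 p p' adm adm' 0 (0, - (n + f n)%:Z).
  apply: block_dist_ge; first by rewrite /norm_inf /=; lia.
  move=> [i1 i2] [j1 j2]; rewrite /block_point /norm_inf /=.
  by have := ltn_ord i2; have := ltn_ord j2; lia.
have [v1 v2] : (absz v.1 <= 1)%N /\ (absz v.2 <= 1)%N.
  by move: vk; rewrite /norm_inf; lia.
(* The top row of the displaced lower block lies [g] rows below the walk, with [g <= f n + 2]. The
   shortcut thus has at most [2 * f n + 5] letters, against [n - 3] for the walk. *)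
pose g := absz ((f n)%:Z + 1 - v.2)%R.
pose h (i j : nat) := z (1 + i%:Z, - j%:Z).
have hh : grid e h.
  by move=> i j; split; apply: hz; rewrite /norm1 /=; lia.
have h0 i : (i <= n - 3)%N -> h i 0%N = nth a (a :: s) i.
  move=> im; rewrite -xs; last by rewrite sm.
  have i1n : (i.+1 < n)%N by lia.
  have := zp (Ordinal i1n, Ordinal n0); rewrite ffunE /x' /block_point !add0r /= => E.
  by rewrite /h; transitivity (z (i.+1%:Z, 0)); [congr z | rewrite E; congr x];
    apply: pair_ext; rewrite /=; lia.
have [c [d [cd shift]]] := checker_shift e_sym ((n : int) - v.1) ab.
have hg i : (i <= n - 3)%N -> h i g = if odd i then d else c.
  move=> im; have ln : (absz (1 + i%:Z - v.1)%R < n)%N by lia.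
  have n1 : (n.-1 < n)%N by lia.
  have := zp' (Ordinal ln, Ordinal n1); rewrite ffunE /block_point /= => E.
  transitivity (checker a b (i%:Z + (n%:Z - v.1))).
    transitivity (checker a b ((absz (1 + i%:Z - v.1)%R)%:Z + n.-1%:Z)); last first.
      by congr checker; lia.
    rewrite -E /h /g; congr z; apply: pair_ext; rewrite /=; lia.
  rewrite shift /checker /par; case: eqP => ci; case: ifP => // ci'; lia.
have [t szt] := row_shortcut e_sym hh cd hg.
have -> : row (h^~ 0%N) (n - 3) = s.
  apply: (@eq_from_nth _ a); rewrite size_mkseq // => i im.
  by rewrite nth_mkseq // h0.
rewrite h0 //= => /far; rewrite /g in szt; lia.
Qed.
End LowerBound.

(** * Existence of the phase and of the least gluing function *)

Section GapFunction.
Variables (A : finType) (X : set (int * int -> A)).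

Lemma phaseP k : 0 < k -> (exists f, phased_block_gluing X f k) ->
  [/\ 0 < phase X, phase X <= k & exists f, phased_block_gluing X f (phase X)].
Proof.
move=> k0 gk; pose P j := 0 < j /\ exists f, phased_block_gluing X f j.
have exP : exists j, `[< P j >] by exists k; apply/asboolP; split.
case: (ex_minnP exP) => j /asboolP Pj minj.
have: exists j, P j /\ forall i, P i -> j <= i.
  by exists j; split=> // i Pi; apply: minj; apply/asboolP.
by move/(xgetPex 0) => [[p0 pf] pmin]; split; [exact: p0 | exact: (pmin k) | exact: pf].
Qed.

Lemma gap_functionP : (exists f, phased_block_gluing X f (phase X)) ->
  phased_block_gluing X (gap_function X) (phase X) /\
  forall g, phased_block_gluing X g (phase X) ->
    forall n, 0 < n -> gap_function X n <= g n.
Proof.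
move=> [f0 gf0].
pose S := [set f | phased_block_gluing X f (phase X) /\
  forall g, phased_block_gluing X g (phase X) -> forall n, 0 < n -> f n <= g n]%classic.
suff exS : exists f, S f by exact: (xgetPex (fun=> 0) exS).
(* Whether [f] is a gluing function is a condition on each value [f n] separately. *)
pose ok n m := phased_block_gluing X (fun l => if l == n then m else f0 l) (phase X).
have okP f : phased_block_gluing X f (phase X) <-> forall n, 0 < n -> ok n (f n).
  split=> [gf n n0 l l0|okf n n0].
    by case: eqP => [->|_]; [exact: gf | exact: gf0].
  by have := okf n n0 n n0; rewrite eqxx.
have /choice[f fP] n : exists m, ok n m /\ forall m', ok n m' -> m <= m'.
  have exok : exists m, `[< ok n m >].
    by exists (f0 n); apply/asboolP => l; case: eqP => [->|_]; exact: gf0.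
  case: (ex_minnP exok) => m /asboolP okm minm.
  by exists m; split=> // m' okm'; apply: minm; apply/asboolP.
exists f; split; first by apply/okP => n _; case: (fP n).
by move=> g /okP okg n n0; apply: (fP n).2; exact: okg.
Qed.

End GapFunction.

Theorem theorem4p24 (V : finType) (e : rel V)
    (e_sym : symmetric e) (e_conn : forall x y : V, connect e x y)
    (cover_infinite : exists a : V, infinite_graph (square_cover e a)) :
  big_Theta (gamma e) (fun n => n).
Proof.
have [a inf] := cover_infinite.
have nbr : has_neighbors e.
  have [s [as_ s1 _]] := long_word e_sym inf 1.
  have [b ab] : exists b, e a b.
    by case: s as_ s1 => // b s /andP[ab _] _; exists b.
  (* A vertex other than [a] has a neighbour on a path to [a]. *)
  move=> c; have /connectP[[|d r] /= cp] := e_conn c a; first by move=> <-; exists b.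
  by move=> _; exists d; case/andP: cp.
have lin2 := phased_block_gluing_linear e_sym (connect_has_walks e_sym e_conn nbr).
have [|p0 p2 pf] := @phaseP V (hom_shift e) 2 isT; first by eexists; exact: lin2.
have [gap_glues gap_min] := gap_functionP pf.
split; last first.
  exists 2, 8; split=> // n n0; exact: gap_lower_bound inf p2 gap_glues n0.
(* The linear bound must hold at the phase itself, which is [1] or [2]. *)
have [N linN] : exists N,
    phased_block_gluing (hom_shift e) (fun n => 3 * n + N + 2) (phase (hom_shift e)).
  case: (phase _) p0 p2 pf => [|[|[|]]] // _ _; last by exists #|V|.
  case=> f /(phased1_has_walks e_sym nbr)/(phased_block_gluing_linear e_sym) lin1.
  by exists (f 1).
exists 3, (N + 2); split=> //; first by rewrite addn2.
by move=> n n0; rewrite addnA; exact: (gap_min _ linN n n0).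
Qed.
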